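(* Let $\beta\in\mathbb{C}$ with $|\beta|>1$ be an algebraic number, and let $\mathcal{A},\mathcal{B}$ be finite alphabets containing $0$ with $\mathcal{A}\cup\mathcal{B}\subset\mathbb{Z}[\beta]$. Suppose that the digit set conversion in base $\beta$ from $\mathcal{A}$ to $\mathcal{B}$ is computable by a $p$-local function $\varphi:\mathcal{A}^{\mathbb{Z}}\to\mathcal{B}^{\mathbb{Z}}$, realized by $\Phi:\mathcal{A}^p\to\mathcal{B}$. If some letter $h\in\mathcal{A}$ is fixed by $\varphi$, i.e. $\Phi(h^p)=h$ (where $h^p$ is the word $hh\cdots h$ of length $p$), then the digit set conversion in base $\beta$ from $\mathcal{A}'=\{a-h : a\in\mathcal{A}\}$ to $\mathcal{B}'=\{b-h: b\in\mathcal{B}\}$ is computable in parallel by a $p$-local function.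
   Context: $\mathbb{Z}[\beta]$ denotes the set of all numbers $\sum_{k=0}^n c_k\beta^k$ with $n\in\mathbb{N}$, $c_k\in\mathbb{Z}$. For finite alphabets $\mathcal{A},\mathcal{B}$, a map $\varphi:\mathcal{A}^{\mathbb{Z}}\to\mathcal{B}^{\mathbb{Z}}$ is $p$-local if there are integers $r,t\geqslant 0$ with $p=r+t+1$ and a map $\Phi:\mathcal{A}^p\to\mathcal{B}$ such that for every $u=(u_j)_{j\in\mathbb{Z}}$ and $v=\varphi(u)$ one has $v_j=\Phi(u_{j+t}\cdots u_j\cdots u_{j-r})$ for all $j\in\mathbb{Z}$ (we say $\varphi$ is realized by $\Phi$). A digit set conversion in base $\beta$ from $\mathcal{A}$ to $\mathcal{B}$ (both containing $0$) is a map $\varphi:\mathcal{A}^{\mathbb{Z}}\to\mathcal{B}^{\mathbb{Z}}$ such that whenever $u$ has finitely many nonzero entries, $v=\varphi(u)$ has finitely many nonzero entries and $\sum_j v_j\beta^j=\sum_j u_j\beta^j$; it is computable in parallel if it is $p$-local for some $p\in\mathbb{N}$. *)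

(* Defs.v *)
From HB Require Import structures.
From mathcomp Require Import all_boot all_order all_algebra.
From mathcomp Require Import finmap.
From mathcomp Require Import all_classical.
From mathcomp Require Export complex reals.

Set Implicit Arguments.
Unset Strict Implicit.
Unset Printing Implicit Defensive.

Import Order.TTheory GRing.Theory Num.Theory.
Local Open Scope classical_set_scope.
Local Open Scope ring_scope.

Definition Zadj (C : unitRingType) (beta : C) : set C :=
  [set x | exists (n : nat) (c : nat -> int),
     x = \sum_(k < n.+1) (c k)%:~R * beta ^+ k].

(* The word x_0 ... x_(p-1) fed to Phi is u_(j+t) ... u_j ... u_(j-r), i.e.
   its letters are listed by decreasing index, with x_i = u_(j+t-i). *)
Definition realized_by (X Y : Type) (p : nat)
    (phi : (int -> X) -> (int -> Y)) (Phi : p.-tuple X -> Y) : Prop :=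
  exists r t : nat, p = (r + t + 1)%N /\
    forall (u : int -> X) (j : int),
      phi u j = Phi [tuple u (j + t%:Z - (i : nat)%:Z) | i < p].

Definition local_fun (X Y : Type) (p : nat)
    (phi : (int -> X) -> (int -> Y)) : Prop :=
  exists Phi : p.-tuple X -> Y, realized_by phi Phi.

Definition fin_nonzero (C : unitRingType) (A : {fset C}) (u : int -> A) : Prop :=
  finite_set [set j : int | val (u j) != 0].

(* The sum runs over the finite set of j whose term is nonzero; it would be 0 by
   convention if that set were infinite, so it is only used below together with
   fin_nonzero. *)
Definition value (C : unitRingType) (beta : C) (A : {fset C}) (u : int -> A) : C :=
  \sum_(j \in [set: int]) (val (u j) * beta ^ j).

Definition digit_set_conversion (C : unitRingType) (beta : C) (A B : {fset C})
    (phi : (int -> A) -> (int -> B)) : Prop :=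
  [/\ 0 \in A, 0 \in B &
      forall u : int -> A, fin_nonzero u ->
        fin_nonzero (phi u) /\ value beta (phi u) = value beta u].

(* Main.v *)
(* The conversion phi' reads u' = u - h and outputs phi u - h.  If u differs
   from h at finitely many positions only, compare the truncations x of u and
   y of the constant word h to a large window, extended by zeros.  Far from the
   perturbation, x and y agree, so the boundary effects of the truncation on
   phi x - x and phi y - y are the same; near it, phi y - y vanishes since h is
   fixed.  Hence phi u - u = (phi x - x) - (phi y - y) at every position, and
   the right-hand side has value 0 because x and y have finite support. *)
Require Import Defs.
From mathcomp Require Import all_boot all_order all_algebra.
From mathcomp Require Import finmap.
From mathcomp Require Import all_classical.
From mathcomp Require Import complex reals.
From mathcomp Require Import zify.

Set Implicit Arguments.
Unset Strict Implicit.

Import GRing.Theory Num.Theory.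
Local Open Scope classical_set_scope.
Local Open Scope ring_scope.

Lemma finite_absz_ball (n : nat) : finite_set [set j : int | (`|j| <= n)%N].
Proof.
apply: (@sub_finite_set _ _ ((fun k : nat => k%:Z - n%:Z : int) @` `I_(n + n).+1)).
  by move=> j /= jn; exists (absz (j + n%:Z)) => /=; lia.
by apply: finite_image; apply: finite_II.
Qed.

Lemma finite_set_absz_bound (S : set int) :
  finite_set S -> exists n : nat, S `<=` [set j : int | (`|j| <= n)%N].
Proof.
move=> /finite_seqP[s ->]; exists (\max_(j <- s) `|j|%N) => j /= js.
exact: (leq_bigmax_seq (F := absz)).
Qed.

Lemma value_widen (C : unitRingType) (beta : C) (A : {fset C}) (u : int -> A)
    (K : set int) : [set j | val (u j) != 0] `<=` K ->
  value beta u = \sum_(j \in K) (val (u j) * beta ^ j).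
Proof.
move=> uK; apply/esym/fsbig_widen => // j [_ Kj] /=.
have [->|/uK//] := eqVneq (val (u j)) 0.
by rewrite mul0r.
Qed.

(** The letters read at [j] have indices from [j - r] to [j + t], and both [r] and [t] are below
    [p]. The symmetric radius [p] is cruder but hides [r] and [t] from later estimates. *)
Lemma realized_by_eq (X Y : Type) (p : nat) (phi : (int -> X) -> int -> Y)
    (Phi : p.-tuple X -> Y) : realized_by phi Phi ->
  forall (u v : int -> X) (j : int),
    (forall k : int, (`|j - k| <= p)%N -> u k = v k) -> phi u j = phi v j.
Proof.
move=> [r [t [pE phiE]]] u v j uv; rewrite !phiE; congr Phi.
by apply: eq_mktuple => i; apply: uv; have := ltn_ord i; lia.
Qed.

Lemma realized_by_const (X Y : Type) (p : nat) (phi : (int -> X) -> int -> Y)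
    (Phi : p.-tuple X -> Y) : realized_by phi Phi ->
  forall (x : X) (j : int), phi (fun=> x) j = Phi (nseq_tuple p x).
Proof.
move=> [r [t [_ phiE]]] x j; rewrite phiE; congr Phi.
by apply: eq_from_tnth => i; rewrite tnth_mktuple tnth_nseq.
Qed.

Section FixedLetter.
Variables (C : unitRingType) (beta : C) (A B : {fset C}) (p : nat).
Variables (phi : (int -> A) -> int -> B) (Phi : p.-tuple A -> B) (h : A).
Hypothesis phi_conv : digit_set_conversion beta phi.
Hypothesis phi_Phi : realized_by phi Phi.
Hypothesis h_fixed : val (Phi (nseq_tuple p h)) = val h.

Lemma fixed_letter_far (u : int -> A) (j : int) :
  (forall k : int, (`|j - k| <= p)%N -> u k = h) -> val (phi u j) = val h.
Proof.
move=> uh.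
by rewrite (realized_by_eq phi_Phi (v := fun=> h) uh) (realized_by_const phi_Phi).
Qed.

(** Neither [u] nor [phi u] need have finite support, so their values cannot be compared directly.
    Their difference does: beyond [M + p] both equal [h], which is why any larger finite [K] gives
    the same sum. *)
Lemma fixed_letter_value (u : int -> A) (M : nat) :
    (forall j, (M < `|j|)%N -> u j = h) ->
  forall K : set int, finite_set K -> [set j | (`|j| <= M + p)%N] `<=` K ->
  \sum_(j \in K) ((val (phi u j) - val (u j)) * beta ^ j) = 0.
Proof.
move=> uh K finK MK; have [A0 B0 conv] := phi_conv.
(* The first [p] covers the positions where [phi u] may differ from [h]; the second keeps the
   windows read at those positions inside the truncation. The padding letter is 0. *)
pose trunc (v : int -> A) (j : int) : A :=
  if (`|j| <= M + p + p)%N then v j else FSetSub A0.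
have trunc_fin v : fin_nonzero (trunc v).
  apply: sub_finite_set (finite_absz_ball (M + p + p)) => j /=.
  by rewrite /trunc; case: ifP => //= _; rewrite eqxx.
pose x := trunc u; pose y := trunc (fun=> h).
have [finx valx] := conv x (trunc_fin _).
have [finy valy] := conv y (trunc_fin _).
have pointwise j : val (phi u j) - val (u j) =
    (val (phi x j) - val (x j)) - (val (phi y j) - val (y j)).
  have [jM|jM] := leqP `|j|%N (M + p).
    have -> : val (phi y j) = val h.
      by apply: fixed_letter_far => k kp; rewrite /y /trunc ifT//; lia.
    have -> : phi x j = phi u j.
      by apply: (realized_by_eq phi_Phi) => k kp; rewrite /x /trunc ifT//; lia.
    have jM' : (`|j| <= M + p + p)%N by lia.
    by rewrite /x /y /trunc jM' subrr subr0.
  (* Here both sides vanish: the window of [j] misses the perturbation, so [x] and [y] agree on it,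
     whether they show [h] or the padding. *)
  have uhj k : (`|j - k| <= p)%N -> u k = h by move=> kp; apply: uh; lia.
  have xy k : (`|j - k| <= p)%N -> x k = y k.
    by move=> kp; rewrite /x /y /trunc uhj.
  rewrite (fixed_letter_far uhj) uhj; last by lia.
  by rewrite (realized_by_eq phi_Phi xy) xy ?subrr//; lia.
(* One finite index set for all four values, so that they can be combined term by term. *)
pose L := K `|` ([set j | val (x j) != 0] `|` [set j | val (y j) != 0] `|`
  ([set j | val (phi x j) != 0] `|` [set j | val (phi y j) != 0])).
have finL : finite_set L.
  by rewrite !finite_setU; do !split => //; apply: trunc_fin.
have -> : \sum_(j \in K) ((val (phi u j) - val (u j)) * beta ^ j) =
          \sum_(j \in L) ((val (phi u j) - val (u j)) * beta ^ j).
  apply: fsbig_widen => [j Kj|j [_ Kj]] /=; first by left.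
  have jM : (M + p < `|j|)%N by rewrite ltnNge; apply/negP => /MK.
  have uhj k : (`|j - k| <= p)%N -> u k = h by move=> kp; apply: uh; lia.
  by rewrite (fixed_letter_far uhj) uhj ?subrr ?mul0r//; lia.
have Lx : [set j | val (x j) != 0] `<=` L by move=> j xj; right; left; left.
have Ly : [set j | val (y j) != 0] `<=` L by move=> j yj; right; left; right.
have Lpx : [set j | val (phi x j) != 0] `<=` L.
  by move=> j xj; right; right; left.
have Lpy : [set j | val (phi y j) != 0] `<=` L.
  by move=> j yj; right; right; right.
move: valx valy; rewrite (value_widen _ Lx) (value_widen _ Ly).
rewrite (value_widen _ Lpx) (value_widen _ Lpy).
rewrite !fsbig_finite//= => valx valy.
under eq_bigr do rewrite pointwise !mulrBl.
by rewrite !sumrB valx valy !subrr.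
Qed.

Lemma fixed_letter_conversion :
  let A' := [fset a - val h | a in A]%fset in
  let B' := [fset b - val h | b in B]%fset in
  exists phi' : (int -> A') -> (int -> B'),
    digit_set_conversion beta phi' /\ local_fun p phi'.
Proof.
move=> A' B'.
have unshiftP (a : A') : val a + val h \in A.
  by have /imfsetP[b /= bA ->] := valP a; rewrite subrK.
pose unshift (a : A') : A := FSetSub (unshiftP a).
have shiftP (b : B) : val b - val h \in B' by apply: in_imfset; apply: valP.
pose shift (b : B) : B' := FSetSub (shiftP b).
pose phi' (u : int -> A') (j : int) := shift (phi (unshift \o u) j).
exists phi'; split; last first.
  (* Translating letters does not move positions, so [r], [t] and hence [p] are kept. *)
  exists (fun w => shift (Phi (map_tuple unshift w))).
  have [r [t [pE phiE]]] := phi_Phi; exists r, t; split=> // u j.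
  rewrite /phi' phiE; congr (shift (Phi _)).
  by apply: eq_from_tnth => i; rewrite tnth_mktuple tnth_map tnth_mktuple.
split.
- by have := in_imfset imfset_key (fun a => a - val h) (valP h); rewrite /= subrr.
(* As an output of [Phi], the letter [h] also lies in [B], so 0 is one of the shifted digits. *)
- by have := shiftP (Phi (nseq_tuple p h)); rewrite h_fixed subrr.
move=> u' finu'; have [M uM] := finite_set_absz_bound finu'.
set u := unshift \o u'.
have uh j : (M < `|j|)%N -> u j = h.
  move=> jM; apply: val_inj => /=.
  have [->|/uM/=] := eqVneq (val (u' j)) 0; first by rewrite add0r.
  by rewrite leqNgt jM.
(* Beyond this radius the window sees only [h], so [phi'] outputs 0. *)
pose K := [set j : int | (`|j| <= M + p)%N].
have finK : finite_set K by apply: finite_absz_ball.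
have phi'K : [set j | val (phi' u' j) != 0] `<=` K.
  move=> j /= nz; rewrite /K /= leqNgt; apply/negP => jM; case/negP: nz.
  by rewrite subr_eq0 (fixed_letter_far (u := u))// => k kp; apply: uh; lia.
split; first exact: sub_finite_set phi'K finK.
have u'K : [set j | val (u' j) != 0] `<=` K.
  by move=> j /uM /= jM; rewrite /K /=; lia.
rewrite (value_widen _ phi'K) (value_widen _ u'K).
(* In the difference of digits the two shifts by [h] cancel, leaving [phi u - u]. *)
apply/eqP; rewrite -subr_eq0 !fsbig_finite//= -sumrB.
rewrite -[X in _ == X](fixed_letter_value uh finK)// fsbig_finite//=.
apply/eqP/eq_bigr => j _.
by rewrite -mulrBl opprD addrA addrAC.
Qed.

End FixedLetter.

Theorem theorem22 (R : realType) (beta : R[i])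
    (beta_alg : algebraicOver (ratr : rat -> R[i]) beta)
    (beta_gt1 : 1 < `|beta|)
    (A B : {fset R[i]})
    (A0 : 0 \in A) (B0 : 0 \in B)
    (ABsub : [set` A] `|` [set` B] `<=` Zadj beta)
    (p : nat)
    (phi : (int -> A) -> (int -> B))
    (Phi : p.-tuple A -> B)
    (phi_conv : digit_set_conversion beta phi)
    (phi_Phi : realized_by phi Phi)
    (h : A)
    (h_fixed : val (Phi (nseq_tuple p h)) = val h) :
  let A' := [fset a - val h | a in A]%fset in
  let B' := [fset b - val h | b in B]%fset in
  exists phi' : (int -> A') -> (int -> B'),
    digit_set_conversion beta phi' /\ local_fun p phi'.
Proof.
exact: fixed_letter_conversion phi_conv phi_Phi h_fixed.
Qed.
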